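(* Let $R$ be a commutative semiring (not assumed to have a multiplicative identity), let $n\geq 1$, and let $A\in M_n(R)$. Then the map $R^n\to R^n$, $x\mapsto Ax$, is surjective if and only if the map $R^n\to R^n$, $x\mapsto A^T x$, is surjective.
   Context: A commutative semiring is a commutative monoid $(R,+,0)$ together with an associative and commutative multiplication that distributes over addition and for which $0$ is absorbing ($0\cdot r=0$ for all $r$). A multiplicative identity is not assumed, and neither is additive cancellation. $M_n(R)$ is the set of $n\times n$ matrices with entries in $R$; a matrix $A=(a_{ij})$ acts on column vectors $x\in R^n$ by $(Ax)_i=\sum_{j=1}^n a_{ij}x_j$, and $A^T$ is the transpose, $(A^T)_{ij}=a_{ji}$. *)

(* Defs.v *)
From HB Require Import structures.
From mathcomp Require Import all_boot all_order all_algebra.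

Set Implicit Arguments.
Unset Strict Implicit.
Unset Printing Implicit Defensive.

Import GRing.Theory.

Local Open Scope ring_scope.

(* MathComp's comPzSemiRingType has a unit. This is the same structure without *)
(* it: the additive part is an nmodType (commutative monoid, no cancellation), *)
(* and 0 absorbs and multiplication distributes on both sides by numulC.       *)
HB.mixin Record Nmodule_isComNuSemiRing R of GRing.Nmodule R := {
  numul : R -> R -> R;
  numulA : associative numul;
  numulC : commutative numul;
  numulDl : left_distributive numul +%R;
  numul0r : left_zero 0 numul
}.

#[short(type="comNuSemiRingType")]
HB.structure Definition ComNuSemiRing :=
  { R of Nmodule_isComNuSemiRing R & GRing.Nmodule R }.

(* mulmx is not available: it requires a multiplicative unit. *)
Definition mxact (R : comNuSemiRingType) (m n : nat)
    (A : 'M[R]_(m, n)) (x : 'cV[R]_n) : 'cV[R]_m :=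
  \col_i \sum_(j < n) numul (A i j) (x j 0).

(* Main.v *)
(* Call an element negatable if it has an additive inverse, and let V be the    *)
(* ideal of negatable elements; a sum lies in V only if each summand does.      *)
(* Let x -> A x be onto. Solving A x = d e_i for every row i in turn makes the  *)
(* off-row terms a_kj x_j negatable, so that, modulo V, each element is a sum   *)
(* of elements p on which A acts as a monomial matrix. For such a p, the vector *)
(* p e_k is in the image of the transpose modulo V, and one also finds that     *)
(* A x in V^n forces x in V^n, hence that A maps V^n onto V^n. It remains to    *)
(* treat the abelian group V, on which the a_ij are commuting endomorphisms,    *)
(* i.e. a module over a commutative ring: if M_r denotes the submodule spanned  *)
(* by the r x r minors of the first r rows applied to V, expanding an           *)
(* (r+1) x (r+1) minor along its last column against a solution of A x = y e_r  *)
(* gives M_r <= M_(r+1). So V = M_0 = M_n = det(A) V, and the adjugate shows    *)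
(* that the transpose is onto.                                                  *)

Require Import Defs.
From HB Require Import structures.
From mathcomp Require Import all_boot all_order all_algebra.
From mathcomp Require Import boolp.

Set Implicit Arguments.
Unset Strict Implicit.
Unset Printing Implicit Defensive.

Import GRing.Theory.

Local Open Scope ring_scope.

(** * Modules over commutative rings *)

(** Transposition is involutive, so one implication suffices. Let V be the group of negatable
    elements. [dual_surj_mod] solves A^T z = d e_k modulo V. The error is a vector over V, so it
    remains to see that A^T maps V^n onto V^n. There subtraction is available and determinants apply
    ([det_surj], [endo_surj_tr], [negatable_surj_tr]), once A is known to map V^n onto V^n, which
    [negatable_reflect] gives. The facts modulo V rest on [monomial_ind]: a zero sum has all its
    terms in V, so modulo V the matrix acts monomially on suitable generators, and for these both
    claims are direct. *)

Definition minor (K : comPzRingType) (m : nat) (A : 'M[K]_m.+1) (r : nat)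
    (g : nat -> 'I_m.+1) : K :=
  \det (\matrix_(i < r, j < r) A (inord i) (g j)).

(** Selecting columns by [g], repetitions allowed, is right multiplication by a 0-1 matrix. *)
Lemma minor_full (K : comPzRingType) (m : nat) (A : 'M[K]_m.+1)
    (g : nat -> 'I_m.+1) :
  minor A m.+1 g = \det A * \det (\matrix_(k < m.+1, j < m.+1) (k == g j)%:R).
Proof.
rewrite -det_mulmx; congr (\det _); apply/matrixP => i j.
rewrite !mxE inord_val (bigD1 (g j)) //= mxE eqxx mulr1 big1 ?addr0 // => k kg.
by rewrite mxE (negPf kg) mulr0.
Qed.

Lemma minor_extend (K : comPzRingType) (V : lmodType K) (m : nat)
    (A : 'M[K]_m.+1) (r : nat) (g : nat -> 'I_m.+1) (y : V)
    (x : 'I_m.+1 -> V) :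
  (r < m.+1)%N ->
  (forall i, \sum_j A i j *: x j = if i == inord r then y else 0) ->
  minor A r g *: y
  = \sum_k minor A r.+1 (fun j => if (j < r)%N then g j else k) *: x k.
Proof.
move=> rm Ax.
(* These cofactors delete the last column, so they do not depend on [k]; [ord0] there is a dummy. *)
pose c (i : 'I_r.+1) : K :=
  cofactor (\matrix_(i < r.+1, j < r.+1)
     A (inord i) (if (j < r)%N then g j else ord0)) i ord_max.
have minE k : minor A r.+1 (fun j => if (j < r)%N then g j else k)
    = \sum_(i < r.+1) A (inord i) k * c i.
  rewrite /minor (expand_det_col _ ord_max); apply: eq_bigr => /= i _.
  rewrite mxE ltnn; congr (_ * _); rewrite /c /cofactor; congr (_ * \det _).
  by apply/matrixP => u v; rewrite !mxE !lift_max !ltn_ord.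
under eq_bigr => k _ do rewrite minE scaler_suml.
have sumE (i : 'I_r.+1) : \sum_k (A (inord i) k * c i) *: x k
    = c i *: (if i == ord_max then y else 0).
  under eq_bigr => k _ do rewrite mulrC -scalerA.
  rewrite -scaler_sumr Ax; congr (_ *: _); congr (if _ then _ else _).
  by rewrite -!val_eqE /= !inordK // (leq_trans (ltn_ord i)).
rewrite exchange_big; under eq_bigr => i _ do rewrite sumE.
rewrite (bigD1 ord_max) //= eqxx big1 ?addr0 => [|i /negPf ->]; last first.
  exact: scaler0.
congr (_ *: _).
rewrite /c /cofactor /= -signr_odd oddD addbb mul1r; congr (\det _).
apply/matrixP => u v.
by rewrite !mxE !lift_max ltn_ord.
Qed.

Lemma det_surj (K : comPzRingType) (V : lmodType K) (m : nat)
    (A : 'M[K]_m.+1) :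
  (forall y : 'I_m.+1 -> V, exists x, forall i, \sum_j A i j *: x j = y i) ->
  forall y : V, exists u, \det A *: u = y.
Proof.
move=> surjA.
(* Downward induction on the size of the minor: full size is a multiple of the determinant, and size
   0 gives the empty minor 1. *)
have minorP d : (d <= m.+1)%N -> forall g (y : V),
    exists u, \det A *: u = minor A (m.+1 - d) g *: y.
  elim: d => [|d IHd] dm g y.
    by rewrite subn0 minor_full -scalerA; eexists.
  have rm : (m.+1 - d.+1 < m.+1)%N by rewrite ltn_subrL.
  have [x Ax] := surjA (fun i => if i == inord (m.+1 - d.+1) then y else 0).
  rewrite (minor_extend g rm Ax) subnSK //.
  have [u Du] := fin_all_exists (fun k : 'I_m.+1 => IHd (ltnW dm)
    (fun j => if (j < m.+1 - d.+1)%N then g j else k) (x k)).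
  exists (\sum_k u k); rewrite scaler_sumr; apply: eq_bigr => k _.
  exact: Du.
move=> y; have [u Du] := minorP _ (leqnn _) (fun=> ord0) y.
by exists u; rewrite Du subnn /minor det_mx00 scale1r.
Qed.

(** If det(A) u = y, then the transposed adjugate applied to u is a preimage of y under the
    transpose. *)
Lemma lmod_surj_tr (K : comPzRingType) (V : lmodType K) (n : nat)
    (A : 'M[K]_n) :
  (forall y : 'I_n -> V, exists x, forall i, \sum_j A i j *: x j = y i) ->
  forall y : 'I_n -> V, exists x, forall i, \sum_j A j i *: x j = y i.
Proof.
case: n A => [|m] A surjA y; first by exists y; case.
have [u Du] := fin_all_exists (fun i => det_surj surjA (y i)).
exists (fun j => \sum_k \adj A k j *: u k) => i.
under eq_bigr => j _ do rewrite scaler_sumr.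
have sumE k : \sum_j A j i *: (\adj A k j *: u k)
    = (\det A *+ (k == i)) *: u k.
  under eq_bigr => j _ do rewrite scalerA mulrC.
  rewrite -scaler_suml; congr (_ *: _).
  by have /matrixP/(_ k i) := mul_adj_mx A; rewrite !mxE.
rewrite exchange_big; under eq_bigr => k _ do rewrite sumE.
by rewrite (bigD1 i) //= eqxx Du big1 ?addr0 // => k /negPf ->; rewrite scale0r.
Qed.

(** * Commuting endomorphisms of an abelian group *)

Section Bicommutant.
Variables (V : zmodType) (I : Type) (a : I -> {additive V -> V}).

(* The bicommutant of a family of commuting endomorphisms is a commutative ring *)
(* containing the family. Commutation with the family itself is a separate      *)
(* field, which makes the ring commutative whatever the family.                 *)
Record bicommutant := Bicommutant {
  bicomm_fun :> V -> V;
  bicommD : {morph bicomm_fun : x y / x + y};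
  bicomm_gen : forall i x, bicomm_fun (a i x) = a i (bicomm_fun x);
  bicommP : forall g : {additive V -> V},
    (forall i x, g (a i x) = a i (g x)) ->
    forall x, bicomm_fun (g x) = g (bicomm_fun x)
}.

Implicit Types f g h : bicommutant.

Lemma bicomm_ext f g : f =1 g -> f = g.
Proof.
case: f g => [f fD fI fC] [g gD gI gC] /= /funext fg; subst g.
by congr Bicommutant; apply: Prop_irrelevance.
Qed.

Lemma bicomm0 f : f 0 = 0.
Proof. by apply: (addrI (f 0)); rewrite -bicommD !addr0. Qed.

HB.instance Definition _ f :=
  GRing.isNmodMorphism.Build V V f (conj (bicomm0 f) (bicommD f)).

Lemma bicommC f g x : f (g x) = g (f x).
Proof. exact: (bicommP f (bicomm_gen g)). Qed.

HB.instance Definition _ := gen_eqMixin bicommutant.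
HB.instance Definition _ := gen_choiceMixin bicommutant.

Definition bicomm_zero : bicommutant.
Proof.
refine (@Bicommutant (fun=> 0) _ _ _) => [x y|i x|k kC x].
- by rewrite addr0.
- by rewrite raddf0.
- by rewrite raddf0.
Defined.

Definition bicomm_one : bicommutant.
Proof.
refine (@Bicommutant id _ _ _) => [x y|i x|k kC x].
- by [].
- by [].
- by [].
Defined.

Definition bicomm_opp f : bicommutant.
Proof.
refine (@Bicommutant (fun x => - f x) _ _ _) => [x y|i x|k kC x].
- by rewrite bicommD opprD.
- by rewrite bicomm_gen raddfN.
- by rewrite bicommP // raddfN.
Defined.

Definition bicomm_add f g : bicommutant.
Proof.
refine (@Bicommutant (fun x => f x + g x) _ _ _) => [x y|i x|k kC x].
- by rewrite !bicommD addrACA.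
- by rewrite !bicomm_gen raddfD.
- by rewrite !bicommP // raddfD.
Defined.

Definition bicomm_mul f g : bicommutant.
Proof.
refine (@Bicommutant (fun x => f (g x)) _ _ _) => [x y|i x|k kC x].
- by rewrite !bicommD.
- by rewrite !bicomm_gen.
- by rewrite (bicommP g kC) (bicommP f kC).
Defined.

Fact bicomm_addA : associative bicomm_add.
Proof. by move=> f g h; apply: bicomm_ext => x; apply: addrA. Qed.

Fact bicomm_addC : commutative bicomm_add.
Proof. by move=> f g; apply: bicomm_ext => x; apply: addrC. Qed.

Fact bicomm_add0 : left_id bicomm_zero bicomm_add.
Proof. by move=> f; apply: bicomm_ext => x; apply: add0r. Qed.

Fact bicomm_addN : left_inverse bicomm_zero bicomm_opp bicomm_add.
Proof. by move=> f; apply: bicomm_ext => x; apply: addNr. Qed.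

HB.instance Definition _ := GRing.isZmodule.Build bicommutant
  bicomm_addA bicomm_addC bicomm_add0 bicomm_addN.

Fact bicomm_mulA : associative bicomm_mul.
Proof. by move=> f g h; apply: bicomm_ext. Qed.

Fact bicomm_mulC : commutative bicomm_mul.
Proof. by move=> f g; apply: bicomm_ext => x; apply: bicommC. Qed.

Fact bicomm_mul1 : left_id bicomm_one bicomm_mul.
Proof. by move=> f; apply: bicomm_ext. Qed.

Fact bicomm_mulDl : left_distributive bicomm_mul +%R.
Proof. by move=> f g h; apply: bicomm_ext. Qed.

HB.instance Definition _ := GRing.Zmodule_isComPzRing.Build bicommutant
  bicomm_mulA bicomm_mulC bicomm_mul1 bicomm_mulDl.

(* The phantom argument selects the ring acting on [V]. *)
Definition bicomm_module (_ : I -> {additive V -> V}) : Type := V.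
HB.instance Definition _ := GRing.Zmodule.copy (bicomm_module a) V.

Definition bicomm_scale f (x : bicomm_module a) : bicomm_module a := f x.

Fact bicomm_scaleA f g x :
  bicomm_scale f (bicomm_scale g x) = bicomm_scale (f * g) x.
Proof. by []. Qed.

Fact bicomm_scale1 : left_id 1 bicomm_scale.
Proof. by []. Qed.

Fact bicomm_scaleDr : right_distributive bicomm_scale +%R.
Proof. by move=> f x y; apply: bicommD. Qed.

Fact bicomm_scaleDl x : {morph bicomm_scale^~ x : f g / f + g}.
Proof. by []. Qed.

HB.instance Definition _ :=
  GRing.Zmodule_isLmodule.Build bicommutant (bicomm_module a)
    bicomm_scaleA bicomm_scale1 bicomm_scaleDr bicomm_scaleDl.

Hypothesis aC : forall i j x, a i (a j x) = a j (a i x).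

Definition bicomm_of (i : I) : bicommutant :=
  @Bicommutant (a i) (raddfD (a i)) (aC i)
    (fun k kC x => esym (kC i x)).

End Bicommutant.

Lemma endo_surj_tr (V : zmodType) (n : nat)
    (a : 'I_n -> 'I_n -> {additive V -> V}) :
  (forall i j k l x, a i j (a k l x) = a k l (a i j x)) ->
  (forall y : 'I_n -> V, exists x, forall i, \sum_j a i j (x j) = y i) ->
  forall y : 'I_n -> V, exists x, forall i, \sum_j a j i (x j) = y i.
Proof.
move=> aC surja; pose b (p : 'I_n * 'I_n) := a p.1 p.2.
have bC p q x : b p (b q x) = b q (b p x) by apply: aC.
pose M := \matrix_(i, j) bicomm_of bC (i, j).
move=> y; have [y'|x Mx] := @lmod_surj_tr _ (bicomm_module b) n M _ y.
  have [x ax] := surja y'; exists x => i; rewrite -ax.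
  by apply: eq_bigr => j _; rewrite mxE.
by exists x => i; rewrite -Mx; apply: eq_bigr => j _; rewrite mxE.
Qed.

(** * Elements with an additive inverse *)

Section Semiring.
Variable R : comNuSemiRingType.
Implicit Types x y z : R.

Local Notation "x ** y" := (numul x y) (at level 40, left associativity).

Lemma numulr0 x : x ** 0 = 0.
Proof. by rewrite numulC numul0r. Qed.

Lemma numulDr : right_distributive (@numul R) +%R.
Proof. by move=> x y z; rewrite !(numulC x) numulDl. Qed.

Lemma numulCA : left_commutative (@numul R).
Proof. by move=> x y z; rewrite !numulA (numulC x). Qed.

Lemma numul_suml (J : Type) (r : seq J) (P : pred J) (F : J -> R) x :
  (\sum_(j <- r | P j) F j) ** x = \sum_(j <- r | P j) F j ** x.
Proof.
by apply: (big_morph (numul^~ x)) => [y z|]; rewrite ?numulDl ?numul0r.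
Qed.

Lemma numul_sumr (J : Type) (r : seq J) (P : pred J) (F : J -> R) x :
  x ** (\sum_(j <- r | P j) F j) = \sum_(j <- r | P j) x ** F j.
Proof. by apply: (big_morph (numul x)) => [y z|]; rewrite ?numulDr ?numulr0. Qed.

Definition negatable x := exists y, x + y = 0.

Lemma negatable0 : negatable 0.
Proof. by exists 0; rewrite addr0. Qed.

Lemma negatableD x y : negatable x -> negatable y -> negatable (x + y).
Proof.
by case=> x' xx' [y' yy']; exists (x' + y'); rewrite addrACA xx' yy' addr0.
Qed.

Lemma negatable_addl x y : negatable (x + y) -> negatable x.
Proof. by case=> z; rewrite -addrA; exists (y + z). Qed.

Lemma negatable_sum (J : Type) (r : seq J) (P : pred J) (F : J -> R) :
  (forall j, P j -> negatable (F j)) -> negatable (\sum_(j <- r | P j) F j).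
Proof. by apply: (big_ind negatable negatable0 negatableD). Qed.

Lemma negatable_summand (J : finType) (F : J -> R) (j : J) :
  negatable (\sum_i F i) -> negatable (F j).
Proof. by rewrite (bigD1 j) //=; apply: negatable_addl. Qed.

Lemma negatableMr x y : negatable x -> negatable (x ** y).
Proof. by case=> z xz; exists (z ** y); rewrite -numulDl xz numul0r. Qed.

Lemma negatableMl x y : negatable y -> negatable (x ** y).
Proof. by rewrite numulC; apply: negatableMr. Qed.

(* Carrying the inverse along makes the negatable elements a subtype defined by *)
(* a boolean predicate.                                                         *)
Record negpair :=
  NegPair { negpair_val :> R * R; _ : negpair_val.1 + negpair_val.2 == 0 }.

HB.instance Definition _ := [isSub for negpair_val].
HB.instance Definition _ := [Choice of negpair by <:].

Lemma negpairP (p : negpair) : p.1 + p.2 = 0.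
Proof. by case: p => p /= /eqP. Qed.

Lemma negpair_ext (p q : negpair) : p.1 = q.1 -> p = q.
Proof.
move=> pq; apply: val_inj; rewrite /= [LHS]surjective_pairing.
rewrite [RHS]surjective_pairing pq; congr pair.
by rewrite -[LHS]add0r -(negpairP q) -pq addrAC negpairP add0r.
Qed.

Definition negpair_of x y (xy : x + y = 0) : negpair :=
  @NegPair (x, y) (introT eqP xy).

Definition negpair_zero : negpair := negpair_of (addr0 0).

Definition negpair_opp (p : negpair) : negpair :=
  negpair_of (etrans (addrC _ _) (negpairP p)).

Fact negpair_add_subproof (p q : negpair) : (p.1 + q.1) + (p.2 + q.2) = 0.
Proof. by rewrite addrACA !negpairP addr0. Qed.

Definition negpair_add (p q : negpair) : negpair :=
  negpair_of (negpair_add_subproof p q).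

Fact negpair_addA : associative negpair_add.
Proof. by move=> p q s; apply: negpair_ext; apply: addrA. Qed.

Fact negpair_addC : commutative negpair_add.
Proof. by move=> p q; apply: negpair_ext; apply: addrC. Qed.

Fact negpair_add0 : left_id negpair_zero negpair_add.
Proof. by move=> p; apply: negpair_ext; apply: add0r. Qed.

Fact negpair_addN : left_inverse negpair_zero negpair_opp negpair_add.
Proof.
by move=> p; apply: negpair_ext; rewrite /= addrC; apply: negpairP.
Qed.

HB.instance Definition _ := GRing.isZmodule.Build negpair
  negpair_addA negpair_addC negpair_add0 negpair_addN.

Fact negpair_mul_subproof x (p : negpair) : x ** p.1 + x ** p.2 = 0.
Proof. by rewrite -numulDr negpairP numulr0. Qed.

Definition negpair_mul x (p : negpair) : negpair :=
  negpair_of (negpair_mul_subproof x p).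

Fact negpair_mul_is_nmod_morphism x :
  nmod_morphism (negpair_mul x).
Proof.
split=> [|p q]; apply: negpair_ext; first exact: numulr0.
exact: numulDr.
Qed.

HB.instance Definition _ x :=
  GRing.isNmodMorphism.Build negpair negpair (negpair_mul x)
    (negpair_mul_is_nmod_morphism x).

Lemma negpair_sum1 (J : finType) (F : J -> negpair) :
  (\sum_j F j).1 = \sum_j (F j).1.
Proof. exact: (big_morph (fun p : negpair => p.1)). Qed.

Lemma negatable_negpair x : negatable x -> exists p : negpair, p.1 = x.
Proof. by case=> y xy; exists (negpair_of xy). Qed.

Lemma negpair_negatable (p : negpair) : negatable p.1.
Proof. by exists p.2; apply: negpairP. Qed.

Lemma negatable_surj_tr (n : nat) (a : 'I_n -> 'I_n -> R) :
  (forall y : 'I_n -> R, (forall i, negatable (y i)) -> exists x : 'I_n -> R,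
     (forall j, negatable (x j)) /\ forall i, \sum_j a i j ** x j = y i) ->
  forall y : 'I_n -> R, (forall i, negatable (y i)) ->
    exists x : 'I_n -> R, forall i, \sum_j a j i ** x j = y i.
Proof.
move=> surja y Vy.
have [q qy] := fin_all_exists (fun i => negatable_negpair (Vy i)).
have [i j k l p|p|x ax] :=
    @endo_surj_tr negpair n (fun i j => negpair_mul (a i j)) _ _ q.
- by apply: negpair_ext; apply: numulCA.
- have [x [Vx ax]] := surja _ (fun i => negpair_negatable (p i)).
  have [s sx] := fin_all_exists (fun j => negatable_negpair (Vx j)).
  exists s => i; apply: negpair_ext; rewrite negpair_sum1 -ax.
  by apply: eq_bigr => j _; rewrite /= sx.
- by exists (fun j => (x j).1) => i; rewrite -qy -ax negpair_sum1.
Qed.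

(** * Decomposition of the semiring modulo the negatable elements *)

Section Surjective.
Variables (n : nat) (a : 'I_n -> 'I_n -> R).
Hypothesis surja :
  forall y : 'I_n -> R, exists x : 'I_n -> R,
    forall i, \sum_j a i j ** x j = y i.

Lemma surj_delta (i : 'I_n) z :
  exists x : 'I_n -> R, \sum_j a i j ** x j = z /\
    forall k j, k != i -> negatable (a k j ** x j).
Proof.
have [x ax] := surja (fun k => if k == i then z else 0).
exists x; split=> [|k j ki]; first by rewrite ax eqxx.
apply: (negatable_summand (F := fun j => a k j ** x j)).
by rewrite ax (negPf ki); apply: negatable0.
Qed.

(* Modulo negatable elements, the matrix acts on such a [p] as a monomial one *)
(* with permutation [s]. *)
Definition monomial p := exists s : 'I_n -> 'I_n, injective s /\
  exists q : 'I_n -> R, (forall i, p = a i (s i) ** q i) /\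
    forall i k m, k != m -> negatable (a k (s m) ** q i).

(** Rows are processed one at a time. In a product [p ** t], the factor [t] is expanded through the
    rows of the matrix and supplies the factor that makes the next row monomial. Carrying [t] along
    replaces a unit. *)
Lemma monomial_ind (J : R -> Prop) :
  (0 < n)%N -> (forall x y, J x -> J y -> J (x + y)) ->
  (forall x, negatable x -> J x) -> (forall p, monomial p -> J p) ->
  forall x, J x.
Proof.
move=> n0 JD JV Jmon.
have Jsum (F : 'I_n -> R) : (forall j, J (F j)) -> J (\sum_j F j).
  by move=> JF; apply: (big_ind J) => //; apply/JV/negatable0.
pose i0 := Ordinal n0.
(* The first [n - d] rows have been processed, [f] giving their columns. *)
have partial d : (d <= n)%N -> forall (f : 'I_n -> 'I_n) (q : 'I_n -> R) p,
    (forall i j : 'I_n, (i < n - d)%N -> (j < n - d)%N ->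
       f i = f j -> i = j) ->
    (forall i : 'I_n, (i < n - d)%N -> p = a i (f i) ** q i) ->
    (forall i k m : 'I_n, (i < n - d)%N -> (m < n - d)%N -> k != m ->
       negatable (a k (f m) ** q i)) ->
    forall t, J (p ** t).
  elim: d => [|d IHd] dn f q p fI pq aq t.
    rewrite subn0 in fI pq aq; apply: Jmon; exists f; split.
      by move=> i j; apply: fI.
    exists (fun i => q i ** t); split=> [i|i k m km].
      by rewrite numulA -pq.
    by rewrite numulA; apply/negatableMr/aq.
  have rn : (n - d.+1 < n)%N by rewrite ltn_subrL.
  have ltr (i : 'I_n) : (i < n - d)%N -> i != Ordinal rn -> (i < n - d.+1)%N.
    rewrite -(subnSK dn) ltnS leq_eqVlt => /orP[/eqP ri|//] /eqP[].
    exact/val_inj.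
  pose r := Ordinal rn.
  have ap (k m : 'I_n) : (m < r)%N -> k != m -> negatable (a k (f m) ** p).
    by move=> mr km; rewrite (pq m mr) numulCA; apply/negatableMl/aq.
  have [y /(_ i0) <-] := surja (fun=> t).
  rewrite numul_sumr; apply/Jsum => j.
  have [x [<- ax]] := surj_delta r (a i0 j).
  rewrite numulA numul_sumr numul_suml; apply/Jsum => l.
  (* A column [l] already used by an earlier row gives a negatable term; a fresh one extends [f] at
     row [r]. *)
  case: (boolP [exists m : 'I_n, (m < r)%N && (f m == l)]) => [|/existsPn fl].
    case/existsP=> m /andP[mr /eqP fm].
    rewrite numulA (numulC p) -fm; apply/JV/negatableMr/negatableMr/ap => //.
    by apply: contraTneq mr => <-; rewrite ltnn.
  have neq_fl (i : 'I_n) : (i < r)%N -> f i <> l.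
    by move=> ir fil; have := fl i; rewrite ir fil eqxx.
  rewrite (numulC p); apply: (IHd (ltnW dn) (fun i => if i == r then l else f i)
    (fun i => if i == r then x l ** p else a r l ** x l ** q i)).
  - move=> i k; case: (i =P r) => [->|/eqP ir];
      case: (k =P r) => [->|/eqP kr] //.
    + by move=> _ /ltr/(_ kr)/neq_fl + /esym.
    + by move=> /ltr/(_ ir)/neq_fl.
    + by move=> /ltr/(_ ir) ? /ltr/(_ kr); apply: fI.
  - move=> i; case: (i =P r) => [->|/eqP ir /ltr/(_ ir)/pq ->].
      by rewrite numulA.
    by rewrite numulCA.
  - move=> i k m + + km; case: (m =P r) km => [->|/eqP mr] km.
      case: (i =P r) => _ _ _.
        by rewrite numulA; apply/negatableMr/ax.
      rewrite (numulC (a r l)) -numulA numulA.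
      by apply/negatableMr/ax.
    case: (i =P r) => [_ _ /ltr/(_ mr)|/eqP ir /ltr/(_ ir) ? /ltr/(_ mr)] mr'.
      by rewrite numulCA; apply/negatableMl/ap.
    by rewrite numulCA; apply/negatableMl/aq.
have Jmul p t : J (p ** t).
  by apply: (partial n _ id (fun=> 0) p) => //; rewrite subnn.
move=> x; have [y /(_ i0) <-] := surja (fun=> x).
by apply/Jsum => j; apply: Jmul.
Qed.

(** For a monomial element with k = s(i), the vector q_i e_i works with [v] = 0; for negatable [d],
    take the zero vector with [v] = [d]. *)
Lemma dual_surj_mod : (0 < n)%N -> forall (k : 'I_n) d, exists z : 'I_n -> R,
  (forall j, j != k -> negatable (\sum_i a i j ** z i)) /\
  exists v, negatable v /\ \sum_i a i k ** z i + v = d.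
Proof.
move=> n0 k; apply: monomial_ind => //.
- move=> d e [z [zj [v [Vv zk]]]] [z' [zj' [v' [Vv' zk']]]].
  have sumE j : \sum_i a i j ** (z i + z' i)
      = \sum_i a i j ** z i + \sum_i a i j ** z' i.
    by rewrite -big_split; apply: eq_bigr => i _; rewrite numulDr.
  exists (fun i => z i + z' i); split=> [j jk|].
    by rewrite sumE; apply: negatableD; [apply: zj | apply: zj'].
  exists (v + v'); split; first exact: negatableD.
  by rewrite sumE addrACA zk zk'.
- move=> d Vd; have sum0 j : \sum_i a i j ** 0 = 0 :> R.
    by apply: big1 => i _; apply: numulr0.
  exists (fun=> 0); split=> [j _|]; first by rewrite sum0; apply: negatable0.
  by exists d; rewrite sum0 add0r.
- move=> p [s [sI [q [pq aq]]]].
  have /codomP[i def_k] : k \in codom s by apply: injF_onto.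
  have sumE j : \sum_m a m j ** (if m == i then q i else 0) = a i j ** q i.
    rewrite (bigD1 i) //= eqxx big1 ?addr0 // => m /negPf ->.
    exact: numulr0.
  exists (fun m => if m == i then q i else 0); split=> [j|].
    have /codomP[m ->] : j \in codom s by apply: injF_onto.
    rewrite def_k sumE (inj_eq sI) eq_sym; exact: aq.
  by exists 0; rewrite sumE addr0 def_k -pq; split=> //; apply: negatable0.
Qed.

(** For x = a_(i,s(i)) q_i, expand an arbitrary factor d as the sum of the a_ij y_j: the term j =
    s(i) of d q_i is a multiple of x, and the others are negatable by monomiality. *)
Lemma negatable_annihilator : (0 < n)%N -> forall x,
  (forall d, negatable (d ** x)) -> negatable x.
Proof.
move=> n0; apply: monomial_ind => //.
- move=> x y annx anny annxy; apply: negatableD; [apply: annx|apply: anny] => d.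
    by have := annxy d; rewrite numulDr; apply: negatable_addl.
  by have := annxy d; rewrite numulDr addrC; apply: negatable_addl.
- move=> p [s [sI [q [pq aq]]]] annp.
  pose i := Ordinal n0; rewrite (pq i).
  suff annq d : negatable (d ** q i) by [].
  have [y /(_ i) <-] := surja (fun=> d).
  rewrite numul_suml; apply: negatable_sum => j _.
  have /codomP[m ->] : j \in codom s by apply: injF_onto.
  have [<-|im] := eqVneq i m.
    by rewrite (numulC (a _ _)) -numulA -pq.
  by rewrite (numulC (a _ _)) -numulA; apply/negatableMl/aq.
Qed.

(** Each a_ij x_j is negatable as a summand. A monomial p with s(i) = k is a multiple of a_ik, so p
    x_k is negatable; hence so is every multiple of x_k. *)
Lemma negatable_reflect (x : 'I_n -> R) :
  (forall i, negatable (\sum_j a i j ** x j)) -> forall k, negatable (x k).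
Proof.
move=> Vax k; have n0 : (0 < n)%N by apply: leq_ltn_trans (ltn_ord k).
apply: (negatable_annihilator n0); apply: monomial_ind => //.
- by move=> d e Vd Ve; rewrite numulDl; apply: negatableD.
- by move=> d; apply: negatableMr.
move=> p [s [sI [q [pq _]]]].
have /codomP[i def_k] : k \in codom s by apply: injF_onto.
rewrite (pq i) -def_k (numulC (a _ _)) -numulA; apply: negatableMl.
exact: (negatable_summand (F := fun j => a i j ** x j)).
Qed.

Lemma surj_tr (y : 'I_n -> R) :
  exists x : 'I_n -> R, forall i, \sum_j a j i ** x j = y i.
Proof.
have [n0|n0] := posnP n.
  by exists y => i; have := ltn_ord i; rewrite {2}n0.
have surjV (v : 'I_n -> R) : (forall i, negatable (v i)) ->
    exists x : 'I_n -> R,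
      (forall j, negatable (x j)) /\ forall i, \sum_j a i j ** x j = v i.
  move=> Vv; have [x ax] := surja v; exists x; split=> //.
  by apply: negatable_reflect => i; rewrite ax.
have unit_tr (k : 'I_n) (d : R) : exists x : 'I_n -> R,
    forall i, \sum_j a j i ** x j = if i == k then d else 0.
  have [z [zV [v [Vv <-]]]] := dual_surj_mod n0 k d.
  (* [w] is the correction, with negatable entries, that turns the solution modulo V into an exact
     one. *)
  have /fin_all_exists[w zw] j : exists w, if j == k then w = v
      else \sum_i a i j ** z i + w = 0.
    have [_|jk] := eqVneq j k; first by exists v.
    by have [w zw] := zV j jk; exists w.
  have [j|x ax] := negatable_surj_tr surjV (y := w).
    have := zw j; have [_ ->//|jk zwj] := eqVneq j k.
    by exists (\sum_i a i j ** z i); rewrite addrC.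
  exists (fun j => z j + x j) => i.
  under eq_bigr => j _ do rewrite numulDr.
  rewrite big_split /= ax; have := zw i.
  by case: eqP => [-> ->|].
(* Superposing the solutions for the y_k e_k gives one for y. *)
have [x ax] := fin_all_exists (fun k => unit_tr k (y k)).
exists (fun j => \sum_k x k j) => i.
under eq_bigr => j _ do rewrite numul_sumr.
rewrite exchange_big; under eq_bigr => k _ do rewrite ax.
rewrite (bigD1 i) //= eqxx big1 ?addr0 // => k /negPf.
by rewrite eq_sym => ->.
Qed.

End Surjective.
End Semiring.

Lemma mxact_surj_tr (R : comNuSemiRingType) (n : nat) (A : 'M[R]_n) :
  (forall y : 'cV[R]_n, exists x : 'cV[R]_n, mxact A x = y) ->
  forall y : 'cV[R]_n, exists x : 'cV[R]_n, mxact A^T x = y.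
Proof.
move=> surjA y; have [y'|x Ax] := @surj_tr R n A _ (fun i => y i 0).
  have [x /colP Ax] := surjA (\col_i y' i).
  by exists (fun j => x j 0) => i; have := Ax i; rewrite !mxE.
exists (\col_j x j); apply/colP => i; rewrite mxE -Ax.
by apply: eq_bigr => j _; rewrite !mxE.
Qed.

Theorem theorem9 (R : comNuSemiRingType) (n : nat) (hn : (1 <= n)%N)
    (A : 'M[R]_n) :
  (forall y : 'cV[R]_n, exists x : 'cV[R]_n, mxact A x = y) <->
  (forall y : 'cV[R]_n, exists x : 'cV[R]_n, mxact A^T x = y).
Proof.
split; first exact: mxact_surj_tr.
by move=> /mxact_surj_tr; rewrite trmxK.
Qed.
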